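(* Let $n$ and $d$ be positive integers with $\gcd(n,d)=1$. Let $r$ be an integer with $\gcd(r,d)=1$, and let $m$ be the least nonnegative residue of $-r/d$ modulo $n$ (i.e. the unique integer $0\le m\le n-1$ with $md\equiv -r \pmod n$). Then, for $M=m$ and for $M=n-1$, \begin{align*} &\sum_{k=0}^M(-1)^kq^{d\binom{k+1}{2}-kr}[2dk+r]\frac{(q^r;q^d)_k^3}{(q^d;q^d)_k^3}\\ &\quad \equiv (-1)^mq^{d\binom{m}{2}+mr}\left([md+r]+[md+r]^3\sum_{k=1}^m\frac{(-1)^kq^{d\binom{k+1}{2}}(1+q^{dk})}{[kd]^2}\right)\pmod{[n]\Phi_n(q)^3}. \end{align*}
   Context: For an integer $x$, $[x]=[x]_q=(1-q^x)/(1-q)$. The $q$-Pochhammer symbol is $(a;q)_0=1$ and $(a;q)_k=(1-a)(1-aq)\cdots(1-aq^{k-1})$ for $k\ge1$. $\Phi_n(q)$ denotes the $n$-th cyclotomic polynomial. For rational functions $A,B$ in $q$ and a polynomial $P(q)$, $A\equiv B \pmod{P(q)}$ means that $(A-B)/P(q)$ is a rational function whose denominator (in lowest terms) is relatively prime to $P(q)$. *)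

(* Defs.v *)
From HB Require Import structures.
From mathcomp Require Import all_boot all_order all_algebra all_field.
Set Implicit Arguments.
Unset Strict Implicit.
Unset Printing Implicit Defensive.
Import GRing.Theory.
Local Open Scope ring_scope.

Notation ratfun := {fraction {poly rat}}.

Definition q : ratfun := tofrac 'X.

Definition qint (x : int) : ratfun := (1 - q ^ x) / (1 - q).

Definition qpoch (a b : ratfun) (k : nat) : ratfun :=
  \prod_(i < k) (1 - a * b ^+ i).

(* The polynomial form of [n], for n a natural number; see qint_polyE. *)
Definition qint_poly (n : nat) : {poly rat} := \sum_(i < n) 'X^i.

Definition cyclotomicQ (n : nat) : {poly rat} :=
  map_poly (intr : int -> rat) 'Phi_n.

(* u / v is the fraction (A - B) / P in lowest terms; it is unique up to a
   common nonzero scalar, so the choice of u and v does not matter. *)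
Definition eqmod (A B : ratfun) (P : {poly rat}) : Prop :=
  P != 0 /\
  exists u v : {poly rat},
    [/\ v != 0, coprimep u v,
        (A - B) / tofrac P = tofrac u / tofrac v & coprimep v P].

Lemma qint_polyE (n : nat) : tofrac (qint_poly n) = qint n%:Z.
Proof.
have q1 : 1 - q != 0.
  rewrite /q -tofrac1 -tofracB tofrac_eq0.
  by rewrite -oppr_eq0 opprB -polyC1 polyXsubC_eq0.
apply: (mulIf q1); rewrite /qint divfK // /qint_poly -exprnP /q.
rewrite -tofrac1 -tofracXn -!tofracB -tofracM; congr tofrac.
by rewrite -[1 - 'X^n]opprB subrX1 -mulNr opprB mulrC.
Qed.

(* Main.v *)
Require Import Defs.
From HB Require Import structures.
From mathcomp Require Import all_boot all_order all_algebra all_field.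
From mathcomp Require Import ring zify.

(* Write Q = q^d, a = q^r and u = a Q^m = q^(md+r), so that u = 1 modulo Phi_n.
   Up to the factor 1/(1-q) the left-hand side is a partial sum S_N(a) of the
   very-well-poised series with general term t(a,k) = [term a k].  This series
   has a WZ certificate R = [cert]: t(a,k) + a t(aQ,k) = R(a,k+1) - R(a,k), so
   that S_N(a) = - a S_N(aQ) + R(a,N).  Running this down from a = u Q^(-m) to u
   expresses S_N(a), up to a monomial, as a known initial value plus m explicit
   boundary terms, each carrying the cube of a quotient of q-shifted factorials
   that is (1 - u)/(1 - Q^j) times a product of factors regular at the
   primitive e-th roots of unity, for every e dividing n.

   For e = n the cube (1 - u)^3 accounts for Phi_n^3, and evaluating the cofactor
   at a primitive n-th root of unity gives the j-th summand of the right-hand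
   side modulo one more Phi_n.  For 1 < e < n every boundary term vanishes at the
   primitive e-th roots of unity: through the cube if e does not divide j, and
   through its remaining linear factor otherwise. *)

Set Implicit Arguments.
Unset Strict Implicit.
Unset Printing Implicit Defensive.
Import Order.TTheory GRing.Theory Num.Theory.
Local Open Scope ring_scope.

(** * Telescoping *)

Lemma bin_succ2 k : 'C(k.+1, 2) = ('C(k, 2) + k)%N.
Proof. by rewrite binS bin1. Qed.

Lemma bin2_double k : ('C(k.+1, 2) * 2 = k.+1 * k)%N.
Proof. by elim: k => // k IH; rewrite bin_succ2 mulnDl IH; lia. Qed.

(** Governs the exponent under the reflection k -> n - k in [sum_summand]; the multiples of n
    disappear at an n-th root of unity. *)
Lemma bin2_reflect n k : (k <= n)%N ->
  ('C((n - k).+1, 2) + n * k = 'C(n, 2) + n + 'C(k, 2))%N.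
Proof.
move=> /subnK; set t := (n - k)%N => <-.
have := bin2_double t; have := bin2_double (t + k); have := bin2_double k.
by rewrite (bin_succ2 (t + k)) (bin_succ2 k); nia.
Qed.

Section Telescoping.

Variables (K : fieldType) (Q : K).
Hypothesis Q0 : Q != 0.
Hypothesis Q1 : forall k : nat, 1 - Q ^+ k.+1 != 0.

Definition poch (a : K) (k : nat) : K := \prod_(i < k) (1 - a * Q ^+ i).

Definition term (a : K) (k : nat) : K :=
  (-1) ^+ k * (Q ^+ 'C(k.+1, 2) / a ^+ k) * (1 - a * Q ^+ (2 * k))
    * (poch a k / poch Q k) ^+ 3.

(* [cert a N] is the WZ certificate R(a, N + 1). *)
Definition cert (a : K) (k : nat) : K :=
  (-1) ^+ k.+1 * Q ^+ 'C(k.+2, 2) / a ^+ k * (a ^+ 2 - (Q ^+ k.+1)^-1)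
    * (poch (a * Q) k / poch Q k) ^+ 3.

Lemma pochS a k : poch a k.+1 = poch a k * (1 - a * Q ^+ k).
Proof. by rewrite /poch big_ord_recr. Qed.

Lemma pochSl a k : poch a k.+1 = (1 - a) * poch (a * Q) k.
Proof.
rewrite /poch big_ord_recl expr0 mulr1; congr (_ * _).
by apply: eq_bigr => i _; rewrite -mulrA -exprS.
Qed.

Lemma pochQ_neq0 k : poch Q k != 0.
Proof. by apply/prodf_neq0 => i _; rewrite -exprS Q1. Qed.

Lemma poch0 a : poch a 0 = 1.
Proof. by rewrite /poch big_ord0. Qed.

Lemma sum_term_shift (a : K) N : a != 0 ->
  \sum_(0 <= k < N.+1) term a k =
    - a * \sum_(0 <= k < N.+1) term (a * Q) k + cert a N.
Proof.
move=> a0; elim: N => [|N IH].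
  rewrite !big_nat1 /term /cert !poch0 muln0 !bin_succ2 /= !expr0 !expr1.
  by field; rewrite oner_eq0.
rewrite [LHS]big_nat_recr // IH [in RHS]big_nat_recr //= mulrDr -!addrA.
congr (_ + _); rewrite /term /cert.
(* Both numerators become multiples of (aQ; Q)_N, so the WZ relation at k = N + 1 is a rational
   identity in a, Q, a^N, Q^N and common factors. *)
rewrite (pochSl a) (pochS (a * Q)) (pochS Q).
rewrite (bin_succ2 N.+2) (bin_succ2 N.+1) mulnS mulnC muln2 -addnn.
rewrite !exprD !exprMn !exprS !expr0.
have := Q1 N; rewrite exprS; have := pochQ_neq0 N.
have := expf_neq0 N Q0; have := expf_neq0 N a0.
set p := poch (a * Q) N; set z := poch Q N; set y := Q ^+ N; set b := a ^+ N.
set s := (-1) ^+ N; set C := Q ^+ 'C(_, _).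
move=> b0 y0 z0 h.
by field; rewrite h z0 b0 y0 Q0 a0.
Qed.

Definition diag_step (a : K) (j : nat) : K :=
  (-1) ^+ j * (Q ^+ 'C(j.+1, 2) / a ^+ j) * (1 - a / Q ^+ j)
    * (poch (a * Q) j / poch Q j) ^+ 3.

(* Here the summation range shrinks together with the power of [Q] in [a], so
   that [diag_step] also absorbs the last summand for [a * Q]. *)
Lemma sum_term_diag (a : K) j : a != 0 ->
  \sum_(0 <= k < j.+2) term a k =
    - a * \sum_(0 <= k < j.+1) term (a * Q) k + diag_step a j.+1.
Proof.
move=> a0; rewrite sum_term_shift // [in LHS]big_nat_recr //= mulrDr -!addrA.
congr (_ + _); rewrite /term /cert /diag_step.
rewrite (bin_succ2 j.+2) mulnS mulnC muln2 -addnn.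
rewrite !exprD !exprMn !exprS !expr0.
have := pochQ_neq0 j.+1.
have := expf_neq0 j Q0; have := expf_neq0 j a0.
set p := poch (a * Q) _; set z := poch Q _; set y := Q ^+ j; set b := a ^+ j.
set s := (-1) ^+ j; set C := Q ^+ 'C(_, _).
move=> b0 y0 z0.
by field; rewrite z0 b0 y0 Q0 a0.
Qed.

(* The factor accumulated when [s (j + 1) = - u / Q^(j + 1) * s j + e j] is
   unrolled from [j] down to [0]. *)
Definition unroll (u : K) (j : nat) : K := (-1) ^+ j * (u ^+ j / Q ^+ 'C(j.+1, 2)).

Lemma unroll_neq0 (u : K) j : u != 0 -> unroll u j != 0.
Proof. by move=> u0; rewrite /unroll !mulf_neq0 ?invr_eq0 ?signr_eq0 ?expf_neq0. Qed.

Lemma unrollE (s e : nat -> K) (u : K) j : u != 0 ->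
  (forall i, (i < j)%N -> s i.+1 = - (u / Q ^+ i.+1) * s i + e i) ->
  s j = unroll u j * (s 0%N + \sum_(i < j) e i / unroll u i.+1).
Proof.
move=> u0; elim: j => [|j IH] hs.
  by rewrite big_ord0 addr0 /unroll !expr0 divr1 !mul1r.
rewrite hs // IH; last by move=> i hi; apply: hs; rewrite ltnS ltnW.
rewrite big_ord_recr /= addrA [RHS]mulrDr.
have h : unroll u j.+1 = - (u / Q ^+ j.+1) * unroll u j.
  rewrite /unroll (bin_succ2 j.+1) exprD !exprS.
  by field; rewrite Q0 !expf_neq0.
have h0 := unroll_neq0 j.+1 u0.
by rewrite [unroll u j.+1 * (e j / _)]mulrC divfK // h; ring.
Qed.

(** At a = u / Q^j the sum stops at k = j, so the recursion ends at the single summand t(u, 0) = 1 -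
    u. *)
Lemma sum_term_diag_unroll (u : K) m : u != 0 ->
  \sum_(0 <= k < m.+1) term (u / Q ^+ m) k =
    unroll u m *
      (1 - u + \sum_(i < m) diag_step (u / Q ^+ i.+1) i.+1 / unroll u i.+1).
Proof.
move=> u0; pose s j := \sum_(0 <= k < j.+1) term (u / Q ^+ j) k.
have -> : 1 - u = s 0%N.
  by rewrite /s big_nat1 /term !poch0 !divr1 !expr1n !mul1r !mulr1.
apply: (@unrollE s (fun i => diag_step (u / Q ^+ i.+1) i.+1)) => // i _.
rewrite /s sum_term_diag; last by rewrite mulf_neq0 ?invr_eq0 ?expf_neq0.
by rewrite exprSr invfM !mulrA divfK.
Qed.

(** With the upper bound N fixed, the recursion ends at the whole sum for a = u. Its part k > 0 is
    handled by [vanishes_sum_term]. *)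
Lemma sum_term_cert_unroll (u : K) m N : u != 0 ->
  \sum_(0 <= k < N.+1) term (u / Q ^+ m) k =
    unroll u m *
      (\sum_(0 <= k < N.+1) term u k
       + \sum_(i < m) cert (u / Q ^+ i.+1) N / unroll u i.+1).
Proof.
move=> u0; pose s j := \sum_(0 <= k < N.+1) term (u / Q ^+ j) k.
have -> : \sum_(0 <= k < N.+1) term u k = s 0%N by rewrite /s divr1.
apply: (@unrollE s (fun i => cert (u / Q ^+ i.+1) N)) => // i _.
rewrite /s sum_term_shift; last by rewrite mulf_neq0 ?invr_eq0 ?expf_neq0.
by rewrite exprSr invfM !mulrA divfK.
Qed.

(** * Extracting the factor 1 - u from quotients of shifted factorials *)

Lemma poch_mulQ a k : poch (a * Q) k = \prod_(l < k) (1 - a * Q ^+ l.+1).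
Proof. by apply: eq_bigr => l _; rewrite -mulrA -exprS. Qed.

Lemma pochQE k : poch Q k = \prod_(l < k) (1 - Q ^+ l.+1).
Proof. by apply: eq_bigr => l _; rewrite -exprS. Qed.

(** Equals -Q^(-L) at U = 1. Kept as a quotient because Q^L may be 1 at the root of unity
    considered; see [regular_factor]. *)
Definition factor (U : K) (L : nat) : K := (1 - U / Q ^+ L) / (1 - Q ^+ L).

Lemma poch_ratio_up u k :
  poch u k.+1 / poch Q k.+1 =
    (1 - u) / (1 - Q ^+ k.+1) *
      \prod_(l < k) ((1 - u * Q ^+ l.+1) / (1 - Q ^+ l.+1)).
Proof.
rewrite pochSl (pochS Q) -exprS prodf_div poch_mulQ pochQE.
by rewrite mulf_div [X in _ / X]mulrC.
Qed.

(** Read backwards, the numerator runs over 1 - u / Q^l for 0 <= l <= i. The factor l = 0 is paired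
    with 1 - Q^(i+1), each other one with the denominator of the same index. *)
Lemma poch_ratio_down u i :
  poch (u / Q ^+ i.+1 * Q) i.+1 / poch Q i.+1 =
    (1 - u) / (1 - Q ^+ i.+1) * \prod_(l < i) factor u l.+1.
Proof.
have -> : poch (u / Q ^+ i.+1 * Q) i.+1 = \prod_(l < i.+1) (1 - u / Q ^+ l).
  rewrite /poch (reindex_inj rev_ord_inj) /=.
  apply: eq_bigr => l _; congr (1 - _).
  have hl : (l <= i)%N by rewrite -ltnS.
  rewrite subSS -{1}(subnK hl) exprS exprD.
  by field; rewrite Q0 !expf_neq0.
rewrite big_ord_recl expr0 divr1 /factor prodf_div pochS -exprS pochQE.
by rewrite mulf_div [X in _ / X]mulrC.
Qed.

(** The k further numerators are reversed, so that 1 - u Q^(k-l) stands over 1 - Q^(i+2+l). These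
    exponents of Q add up to i + 2 + k, which is n in the application, so at a root of unity the
    numerator vanishes whenever the denominator does. *)
Lemma poch_ratio_full u i k :
  poch (u / Q ^+ i.+1 * Q) (i.+1 + k) / poch Q (i.+1 + k) =
    (1 - u) / (1 - Q ^+ i.+1) * \prod_(l < i) factor u l.+1
      * \prod_(l < k) factor (u * Q ^+ (i.+2 + k)) (i.+2 + l).
Proof.
have pochD a j : poch a (j + k) = poch a j * \prod_(l < k) (1 - a * Q ^+ (j + l)).
  by rewrite /poch big_split_ord.
rewrite -poch_ratio_down !pochD -mulf_div; congr (_ * _).
rewrite /factor prodf_div; congr (_ / _).
rewrite (reindex_inj rev_ord_inj) /=; apply: eq_bigr => l _; congr (1 - _).
have -> : (i.+2 + k = i.+1 + (k - l.+1) + l.+2)%N by have := ltn_ord l; lia.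
rewrite !(exprD, exprS).
by field; rewrite Q0 !expf_neq0.
Qed.

End Telescoping.

(** * Rational functions regular at a root of unity *)

Section LocalRing.

Variable z : algC.

Definition evalQ (p : {poly rat}) : algC := (map_poly ratr p).[z].

Lemma evalQD p1 p2 : evalQ (p1 + p2) = evalQ p1 + evalQ p2.
Proof. by rewrite /evalQ rmorphD hornerD. Qed.

Lemma evalQM p1 p2 : evalQ (p1 * p2) = evalQ p1 * evalQ p2.
Proof. by rewrite /evalQ rmorphM hornerM. Qed.

Lemma evalQ1 : evalQ 1 = 1.
Proof. by rewrite /evalQ rmorph1 hornerC. Qed.

Lemma evalQN p : evalQ (- p) = - evalQ p.
Proof. by rewrite /evalQ rmorphN hornerN. Qed.

Lemma tofrac_neq0 v : evalQ v != 0 -> tofrac v != 0.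
Proof.
rewrite tofrac_eq0; apply: contraNneq => ->.
by rewrite /evalQ rmorph0 horner0.
Qed.

(* [x] is regular at [z] with value [c]. *)
Definition loc (x : ratfun) (c : algC) : Prop :=
  exists u v : {poly rat},
    [/\ evalQ v != 0, x = tofrac u / tofrac v & c = evalQ u / evalQ v].

Lemma loc_tofrac p : loc (tofrac p) (evalQ p).
Proof. by exists p, 1; rewrite evalQ1 oner_eq0 tofrac1 !divr1. Qed.

Lemma loc1 : loc 1 1.
Proof. by have := loc_tofrac 1; rewrite tofrac1 evalQ1. Qed.

Lemma locN x c : loc x c -> loc (- x) (- c).
Proof.
case=> u [v [hv -> ->]]; exists (- u), v; split=> //.
  by rewrite tofracN mulNr.
by rewrite evalQN mulNr.
Qed.

Lemma locD x y c1 c2 : loc x c1 -> loc y c2 -> loc (x + y) (c1 + c2).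
Proof.
case=> u [v [hv -> ->]] [u' [v' [hv' -> ->]]].
exists (u * v' + u' * v), (v * v'); split.
- by rewrite evalQM mulf_neq0.
- by rewrite tofracD !tofracM addf_div // tofrac_neq0.
- by rewrite evalQD !evalQM addf_div.
Qed.

Lemma locB x y c1 c2 : loc x c1 -> loc y c2 -> loc (x - y) (c1 - c2).
Proof. by move=> h1 h2; apply/locD/locN. Qed.

Lemma locM x y c1 c2 : loc x c1 -> loc y c2 -> loc (x * y) (c1 * c2).
Proof.
case=> u [v [hv -> ->]] [u' [v' [hv' -> ->]]].
exists (u * u'), (v * v'); split.
- by rewrite evalQM mulf_neq0.
- by rewrite !tofracM mulf_div.
- by rewrite !evalQM mulf_div.
Qed.

Lemma locV x c : c != 0 -> loc x c -> loc x^-1 c^-1.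
Proof.
move=> hc [u [v [hv -> Dc]]].
have hu : evalQ u != 0 by apply: contraNneq hc => hu; rewrite Dc hu mul0r.
by exists v, u; split; rewrite // ?Dc invf_div.
Qed.

Lemma loc_div x y c1 c2 : c2 != 0 -> loc x c1 -> loc y c2 -> loc (x / y) (c1 / c2).
Proof. by move=> h h1 h2; apply/locM/locV. Qed.

Lemma locX x c k : loc x c -> loc (x ^+ k) (c ^+ k).
Proof.
move=> h; elim: k => [|k IH]; first by rewrite !expr0; apply: loc1.
by rewrite !exprS; apply: locM.
Qed.

Lemma loc_prod (I : finType) (F : I -> ratfun) (c : I -> algC) :
  (forall i, loc (F i) (c i)) -> loc (\prod_i F i) (\prod_i c i).
Proof.
move=> h; apply: (big_rec2 loc) => [|i y x _ IH]; first exact: loc1.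
exact: locM.
Qed.

Lemma loc_sum (I : finType) (F : I -> ratfun) (c : I -> algC) :
  (forall i, loc (F i) (c i)) -> loc (\sum_i F i) (\sum_i c i).
Proof.
move=> h; apply: (big_rec2 loc) => [|i y x _ IH]; last exact: locD.
have := locB loc1 loc1; by rewrite !subrr.
Qed.

Lemma loc_q : loc q z.
Proof.
have -> : z = evalQ 'X by rewrite /evalQ map_polyX hornerX.
exact: loc_tofrac.
Qed.

Definition regular (x : ratfun) : Prop := exists c, loc x c.

Lemma regularM x y : regular x -> regular y -> regular (x * y).
Proof. by move=> [c h] [c' h']; exists (c * c'); apply: locM. Qed.

Lemma regularD x y : regular x -> regular y -> regular (x + y).
Proof. by move=> [c h] [c' h']; exists (c + c'); apply: locD. Qed.

Lemma regularX x k : regular x -> regular (x ^+ k).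
Proof. by move=> [c h]; exists (c ^+ k); apply: locX. Qed.

Lemma regular_prod (I : finType) (F : I -> ratfun) :
  (forall i, regular (F i)) -> regular (\prod_i F i).
Proof.
move=> h; apply: (big_ind regular) => //; first by exists 1; apply: loc1.
exact: regularM.
Qed.

End LocalRing.

(** * Order of vanishing along Phi_e, read off at a primitive e-th root of unity *)

Section CyclotomicDivisibility.

Variables (e : nat) (z : algC).
Hypothesis hz : e.-primitive_root z.

(** Phi_e is the minimal polynomial of [z] over the rationals. *)
Lemma cyclotomicQ_dvd p : (cyclotomicQ e %| p)%R = (evalQ z p == 0).
Proof.
have [Phi [hPhi _] hroot] := minCpolyP z.
rewrite /evalQ -/(root _ z) hroot; congr (_ %| _)%R.
apply: (@map_poly_inj _ _ (ratr : {rmorphism rat -> algC})).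
rewrite -hPhi (minCpoly_cyclotomic hz) -(Cintr_Cyclotomic hz) /cyclotomicQ.
by rewrite -map_poly_comp; apply: eq_map_poly => x /=; rewrite ratr_int.
Qed.

Lemma cyclotomicQ_neq0 : cyclotomicQ e != 0.
Proof.
have monPhi := Cyclotomic_monic e.
by rewrite map_poly_eq0_id0 ?monic_neq0 // (monicP monPhi).
Qed.

Lemma cyclotomicQ_coprime p : evalQ z p != 0 -> coprimep (cyclotomicQ e) p.
Proof.
move=> hp; rewrite /coprimep.
have /dvdpP [g Dg] := dvdp_gcdl (cyclotomicQ e) p.
have Phi0 := cyclotomicQ_neq0.
have : evalQ z (cyclotomicQ e) == 0 by rewrite -cyclotomicQ_dvd dvdpp.
(* Either [z] is a root of [g], so Phi_e divides [g] and the gcd is constant by degree, or it is a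
   root of the gcd and hence of [p]. *)
rewrite [X in evalQ z X]Dg evalQM mulf_eq0 => /orP [|h].
  rewrite -cyclotomicQ_dvd => /dvdp_leq.
  have g0 : g != 0 by apply: contraNneq Phi0 => g0; rewrite Dg g0 mul0r.
  have gcd0 : gcdp (cyclotomicQ e) p != 0.
    by apply: contraNneq Phi0 => h; rewrite Dg h mulr0.
  rewrite g0 {1}Dg size_mul // => /(_ isT).
  have := size_poly_eq0 (gcdp (cyclotomicQ e) p); rewrite (negbTE gcd0).
  have := size_poly_eq0 g; rewrite (negbTE g0).
  by move: (size g) (size (gcdp _ _)) => sg sd; lia.
case/dvdpP: (dvdp_gcdr (cyclotomicQ e) p) => g' Dp.
by move: hp; rewrite Dp evalQM (eqP h) mulr0 eqxx.
Qed.

Lemma prim_root_neq0 : z != 0.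
Proof.
apply/eqP => z0; have := prim_expr_order hz.
rewrite z0 expr0n eqn0Ngt (prim_order_gt0 hz) => /eqP.
by rewrite eq_sym oner_eq0.
Qed.

Definition vanishes (k : nat) (x : ratfun) : Prop :=
  exists2 y, regular z y & x = tofrac (cyclotomicQ e) ^+ k * y.

Lemma vanishesD k x y : vanishes k x -> vanishes k y -> vanishes k (x + y).
Proof.
move=> [x' hx ->] [y' hy ->]; exists (x' + y'); first exact: regularD.
by rewrite mulrDr.
Qed.

Lemma vanishesN k x : vanishes k x -> vanishes k (- x).
Proof.
move=> [y [c hy] ->]; exists (- y); last by rewrite mulrN.
by exists (- c); apply: locN.
Qed.

Lemma vanishesB k x y : vanishes k x -> vanishes k y -> vanishes k (x - y).
Proof. by move=> hx hy; apply/vanishesD/vanishesN. Qed.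

Lemma vanishesM j k x y : vanishes j x -> vanishes k y -> vanishes (j + k) (x * y).
Proof.
move=> [x' hx ->] [y' hy ->]; exists (x' * y'); first exact: regularM.
by rewrite exprD mulrACA.
Qed.

Lemma vanishesMr k x y : vanishes k x -> regular z y -> vanishes k (x * y).
Proof.
by move=> hx hy; rewrite -(addn0 k); apply: vanishesM => //; exists y; rewrite ?mul1r.
Qed.

Lemma vanishesMl k x y : regular z x -> vanishes k y -> vanishes k (x * y).
Proof. by move=> hx hy; rewrite mulrC; apply: vanishesMr. Qed.

Lemma vanishes0 k : vanishes k 0.
Proof.
exists 0; rewrite ?mulr0 //; exists 0.
by have := loc_tofrac z 0; rewrite tofrac0 /evalQ rmorph0 horner0.
Qed.

Lemma vanishes_sum (I : finType) (F : I -> ratfun) k :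
  (forall i, vanishes k (F i)) -> vanishes k (\sum_i F i).
Proof.
move=> h; apply: (big_ind (vanishes k)) => //; first exact: vanishes0.
exact: vanishesD.
Qed.

Lemma vanishesX k l x : vanishes k x -> vanishes (k * l) (x ^+ l).
Proof.
move=> [y hy ->]; exists (y ^+ l); first exact: regularX.
by rewrite exprMn -exprM.
Qed.

Lemma vanishes_regular k x : vanishes k x -> regular z x.
Proof.
case=> y hy ->; apply: regularM => //; apply: regularX.
by exists (evalQ z (cyclotomicQ e)); apply: loc_tofrac.
Qed.

Lemma loc0_vanishes x : loc z x 0 -> vanishes 1 x.
Proof.
case=> u [v [hv -> /esym/eqP]]; rewrite mulf_eq0 invr_eq0 (negbTE hv) orbF.
rewrite -cyclotomicQ_dvd => /dvdpP [p ->].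
exists (tofrac p / tofrac v); last by rewrite expr1 tofracM [RHS]mulrCA mulrA.
by exists (evalQ z p / evalQ z v), p, v.
Qed.

(** The denominator of the regular cofactor is coprime to Phi_e, so after cross-multiplication
    Gauss's lemma moves the power of Phi_e onto [u]. *)
Lemma vanishes_dvdp k (u v : {poly rat}) : v != 0 ->
  vanishes k (tofrac u / tofrac v) -> (cyclotomicQ e ^+ k %| u)%R.
Proof.
move=> v0 [x [c [u' [v' [hv' -> _]]]] h].
have v'0 := tofrac_neq0 hv'; rewrite -tofrac_eq0 in v0.
have cop : coprimep (cyclotomicQ e ^+ k) v' by apply/coprimep_expl/cyclotomicQ_coprime.
rewrite -(Gauss_dvdpl _ cop).
have /eqP : tofrac (u * v') = tofrac (cyclotomicQ e ^+ k * (u' * v)).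
  move: h; rewrite -tofracXn mulrA -tofracM => /eqP.
  rewrite (eqr_div _ _ v0 v'0) => /eqP h.
  by rewrite tofracM h -tofracM mulrA.
by rewrite tofrac_eq => /eqP ->; apply: dvdp_mulr.
Qed.

End CyclotomicDivisibility.

(** * Values at roots of unity *)

Section RootOfUnity.

Variables (F : fieldType) (w : F).
Hypothesis w0 : w != 0.

(** For w = q^d this is the j-th summand of the right-hand side divided by (1 - q)^2; for w a root
    of unity it is the value of that quotient. *)
Definition summand (j : nat) : F :=
  (-1) ^+ j * w ^+ 'C(j.+1, 2) * (1 + w ^+ j) / (1 - w ^+ j) ^+ 2.

Lemma cube_summand x j :
  x ^+ 3 * summand j = x * ((x / (1 - w ^+ j)) ^+ 2
    * ((-1) ^+ j * w ^+ 'C(j.+1, 2) * (1 + w ^+ j))).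
Proof. by rewrite /summand exprMn exprVn; ring. Qed.

Lemma expr_bin_succ2 k : w ^+ 'C(k.+1, 2) = w ^+ 'C(k, 2) * w ^+ k.
Proof. by rewrite -exprD -bin_succ2. Qed.

Lemma prodN_expV m :
  \prod_(l < m) - (w ^+ l.+1)^-1 = (-1) ^+ m / w ^+ 'C(m.+1, 2).
Proof.
elim: m => [|m IH]; first by rewrite big_ord0 !expr0 divr1.
rewrite big_ord_recr /= IH (expr_bin_succ2 m.+1) !exprS.
by field; rewrite w0 !expf_neq0.
Qed.

(** The left side is the cofactor of (1 - u)^3 in the diagonal boundary term, with u replaced by 1
    and Q by w. *)
Lemma diag_limit i : 1 - w ^+ i.+1 != 0 ->
  (-1) ^+ i.+1 * (w ^+ 'C(i.+2, 2) / (1 / w ^+ i.+1) ^+ i.+1)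
    * (1 - 1 / w ^+ i.+1 / w ^+ i.+1)
    * ((\prod_(l < i) - (w ^+ l.+1)^-1) * (1 - w ^+ i.+1)^-1) ^+ 3
    * (unroll w 1 i.+1)^-1 = summand i.+1.
Proof.
rewrite prodN_expV /summand /unroll (expr_bin_succ2 i.+1).
have -> : (1 / w ^+ i.+1) ^+ i.+1 = (w ^+ 'C(i.+1, 2) ^+ 2 * w ^+ i.+1)^-1.
  rewrite expr_div_n expr1n div1r -exprM; congr (_^-1).
  rewrite -exprM -exprD; congr (_ ^+ _).
  by rewrite bin2_double; lia.
rewrite -[(-1) ^+ i]signr_odd.
have := expf_neq0 'C(i.+1, 2) w0; have := expf_neq0 i.+1 w0.
(* Splitting on parity makes the signs constants, which [field] can cancel. *)
rewrite [(-1) ^+ i.+1]exprS -[(-1) ^+ i]signr_odd expr1n.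
set y := w ^+ i.+1; set c := w ^+ 'C(_, _) => y0 c0 h.
by case: (odd i); rewrite ?expr1 ?expr0; field; rewrite h y0 c0 ?oppr_eq0 oner_eq0.
Qed.

Lemma term_limit i : 1 - w ^+ i.+1 != 0 ->
  (-1) ^+ i.+1 * (w ^+ 'C(i.+2, 2) / 1 ^+ i.+1) * (1 - 1 * w ^+ (2 * i.+1))
    * ((\prod_(l < i) 1) * (1 - w ^+ i.+1)^-1) ^+ 3 * 1 = summand i.+1.
Proof.
rewrite big1 // /summand expr1n mulnC exprM; move: (w ^+ i.+1) => y y1.
by field; rewrite ?y1 ?oner_eq0.
Qed.

Variable n : nat.
Hypothesis hw : n.-primitive_root w.

Lemma exp_order_sub l : (l <= n)%N -> w ^+ (n - l) = (w ^+ l)^-1.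
Proof.
move=> ln; apply: (mulIf (expf_neq0 l w0)).
by rewrite -exprD subnK // (prim_expr_order hw) mulVf ?expf_neq0.
Qed.

Lemma one_sub_exp_neq0 l : (0 < l < n)%N -> 1 - w ^+ l != 0.
Proof.
move=> /andP [l0 ln]; rewrite subr_eq0 eq_sym -(prim_order_dvd hw).
by apply/negP => /(dvdn_leq l0); rewrite leqNgt ln.
Qed.

(* The product of the [1 - w^l] is unchanged when [w] is replaced by [w^-1]. *)
Lemma prodN_expV_full : \prod_(l < n.-1) - (w ^+ l.+1)^-1 = 1.
Proof.
have n0 := prim_order_gt0 hw.
pose P := \prod_(l < n.-1) (1 - w ^+ l.+1).
have P0 : P != 0.
  by apply/prodf_neq0 => l _; rewrite one_sub_exp_neq0 //=; have := ltn_ord l; lia.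
apply: (mulIf P0); rewrite mul1r /P [RHS](reindex_inj rev_ord_inj) -big_split /=.
apply: eq_bigr => l _.
have -> : (n.-1 - l.+1).+1 = (n - l.+1)%N by have := ltn_ord l; lia.
have ln : (l.+1 <= n)%N by have := ltn_ord l; lia.
by rewrite exp_order_sub // mulrBr mulr1 mulNr mulVf ?expf_neq0 // opprK addrC.
Qed.

(** Compares the two evaluations of the product of the -w^(-l) for 0 < l < n; no case split on the
    parity of n is required. *)
Lemma sign_exp_bin2 : (-1) ^+ n * w ^+ 'C(n, 2) = -1.
Proof.
have := prodN_expV_full; rewrite prodN_expV (prednK (prim_order_gt0 hw)).
move/(canRL (divfK (expf_neq0 _ w0))); rewrite mul1r => <-.
by rewrite -{1}(prednK (prim_order_gt0 hw)) exprS -mulrA -expr2 sqrr_sign mulr1.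
Qed.

Lemma cert_limit i k : n = (i.+1 + k).+1 ->
  (-1) ^+ (i.+1 + k).+1 * w ^+ 'C((i.+1 + k).+2, 2) / (1 / w ^+ i.+1) ^+ (i.+1 + k)
    * ((1 / w ^+ i.+1) ^+ 2 - (w ^+ (i.+1 + k).+1)^-1)
    * ((\prod_(l < i) - (w ^+ l.+1)^-1)
       * (\prod_(l < k) - (w ^+ (i.+2 + l))^-1) * (1 - w ^+ i.+1)^-1) ^+ 3
    * (unroll w 1 i.+1)^-1 = summand i.+1.
Proof.
move=> Dn; rewrite -Dn; have -> : (i.+1 + k)%N = n.-1 by rewrite Dn.
have n0 := prim_order_gt0 hw.
have y0 := expf_neq0 i.+1 w0.
have y1 : 1 - w ^+ i.+1 != 0 by apply: one_sub_exp_neq0; lia.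
(* The full product over 0 < l < n is 1, and only its factor -w^(-(i+1)) is missing here. *)
have -> : (\prod_(l < i) - (w ^+ l.+1)^-1) * (\prod_(l < k) - (w ^+ (i.+2 + l))^-1)
    = - w ^+ i.+1.
  have := prodN_expV_full; have -> : n.-1 = (i.+1 + k)%N by rewrite Dn.
  rewrite big_split_ord big_ord_recr /= => h; rewrite -[RHS]mul1r -[X in _ = X * _]h.
  move: y0; set y := w ^+ i.+1 => y0.
  by rewrite [RHS]mulrAC -[X in _ = X * _]mulrA mulrNN mulVf // mulr1.
have -> : (1 / w ^+ i.+1) ^+ n.-1 = w ^+ i.+1.
  apply: (mulIf (_ : (1 / w ^+ i.+1) != 0)); first by rewrite div1r invr_eq0.
  rewrite -exprSr (prednK n0) expr_div_n expr1n -exprM mulnC exprM.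
  by rewrite (prim_expr_order hw) expr1n divr1 mulrC divfK.
rewrite (expr_bin_succ2 n) [(-1) ^+ n * (_ * _)]mulrA sign_exp_bin2.
rewrite (prim_expr_order hw).
rewrite /summand /unroll expr1n.
have := expf_neq0 'C(i.+2, 2) w0.
rewrite -[(-1) ^+ i.+1]signr_odd.
move: y0 y1; set y := w ^+ i.+1; set c := w ^+ 'C(_, _) => y0 y1 c0.
by case: (odd _); rewrite ?expr1 ?expr0; field; rewrite ?y1 ?y0 ?c0 ?oppr_eq0 ?oner_eq0.
Qed.

(** The reflection k -> n - k changes the sign of the summand, so twice the sum is 0. *)
Lemma sum_summand : 2%:R != 0 :> F -> \sum_(k < n.-1) summand k.+1 = 0.
Proof.
move=> two0; apply: (mulfI two0); rewrite mulr0 mulr_natl mulr2n.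
rewrite {1}(reindex_inj rev_ord_inj) -big_split big1 //= => k _.
have n0 := prim_order_gt0 hw.
have ln : (k.+1 < n)%N by have := ltn_ord k; lia.
have -> : (n.-1 - k.+1).+1 = (n - k.+1)%N by lia.
have wnk := exp_order_sub (ltnW ln).
have bnk : w ^+ 'C((n - k.+1).+1, 2) = w ^+ 'C(n, 2) * w ^+ 'C(k.+1, 2).
  have h := bin2_reflect (ltnW ln).
  have : w ^+ ('C((n - k.+1).+1, 2) + n * k.+1) = w ^+ ('C(n, 2) + n + 'C(k.+1, 2)).
    by rewrite h.
  by rewrite !exprD exprM (prim_expr_order hw) expr1n !mulr1.
have sk : (-1) ^+ (n - k.+1) = (-1) ^+ n * (-1) ^+ k.+1 :> F.
  by rewrite -signr_odd oddB ?(ltnW ln) // signr_addb !signr_odd.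
rewrite /summand wnk bnk sk (expr_bin_succ2 k.+1).
have y0 := expf_neq0 k.+1 w0.
have y1 : 1 - w ^+ k.+1 != 0 by apply: one_sub_exp_neq0.
have := sign_exp_bin2.
move: y0 y1; set y := w ^+ k.+1; set c := w ^+ 'C(k.+1, _); set s := _ ^+ k.+1.
set a := _ ^+ n; set b := _ ^+ 'C(n, _) => y0 y1 hab.
have -> : a * s * (b * c) = - (s * c) by rewrite mulrACA hab mulN1r.
have y2 : y - 1 != 0 by rewrite -opprB oppr_eq0.
by field; rewrite ?y0 ?y1 ?y2.
Qed.

End RootOfUnity.

Lemma q_neq0 : q != 0.
Proof. by rewrite tofrac_eq0 polyX_eq0. Qed.

Lemma one_subq_neq0 k : (0 < k)%N -> 1 - q ^+ k != 0.
Proof.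
move=> k0; rewrite -tofracXn -tofrac1 -tofracB tofrac_eq0 -opprB oppr_eq0.
by rewrite -size_poly_eq0 -polyC1 size_XnsubC.
Qed.

(** * Powers of q near a primitive e-th root of unity *)

Section LocalPowers.

Variables (e : nat) (z : algC).
Hypothesis hz : e.-primitive_root z.

Lemma loc_qz (A : int) : loc z (q ^ A) (z ^ A).
Proof.
case: A => k; first by rewrite -!exprnP; apply/locX/loc_q.
rewrite NegzE -!exprnN; apply: locV; first by rewrite expf_neq0 // (prim_root_neq0 hz).
exact/locX/loc_q.
Qed.

Lemma prim_expz (A : int) : (e %| A)%Z -> z ^ A = 1.
Proof.
case/dvdzP => b ->; rewrite mulrC -exprz_exp -exprnP (prim_expr_order hz).
exact: exp1rz.
Qed.

Lemma vanishes_one_subq (A : int) : (e %| A)%Z -> vanishes e z 1 (1 - q ^ A).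
Proof.
move=> hA; apply: (loc0_vanishes hz).
by have := locB (loc1 z) (loc_qz A); rewrite prim_expz // subrr.
Qed.

(** If e divides B, both exponents are multiples of e. With y = q^e the common factor 1 - y cancels,
    leaving geometric sums whose values at y = 1 are integers, nonzero in the denominator. A
    negative A only contributes a unit -y^(-k). *)
Lemma regular_ratio (A : int) (B : nat) : (0 < B)%N ->
  ((e %| B)%N -> (e %| A)%Z) -> regular z ((1 - q ^ A) / (1 - q ^+ B)).
Proof.
move=> B0; have [eB hA | eB _] := boolP (e %| B)%N; last first.
  exists ((1 - z ^ A) / (1 - z ^+ B)); apply: loc_div.
  - by rewrite subr_eq0 eq_sym -(prim_order_dvd hz).
  - by apply: locB (loc1 z) (loc_qz A).
  - by apply: locB (loc1 z) (locX _ (loc_q z)).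
have e0 := prim_order_gt0 hz.
have [b DB] := dvdnP eB; have [a DA] := dvdzP (hA isT).
have b0 : (0 < b)%N by case: b DB B0 => // ->.
pose y := q ^+ e; have y1 : 1 - y != 0 by apply: one_subq_neq0.
have hy : loc z y 1 by rewrite -(prim_expr_order hz); apply/locX/loc_q.
have geo k : 1 - y ^+ k = (1 - y) * \sum_(i < k) y ^+ i.
  by rewrite -[LHS]opprB subrX1 -mulNr opprB.
have hsum k : loc z (\sum_(i < k) y ^+ i) k%:R.
  have -> : k%:R = \sum_(i < k) 1 :> algC by rewrite sumr_const card_ord.
  by apply: loc_sum => i; rewrite -(expr1n algC i); apply: locX.
have hden : 1 - q ^+ B = (1 - y) * \sum_(i < b) y ^+ i.
  by rewrite DB mulnC exprM geo.
have hnum k : regular z ((1 - y ^+ k) / (1 - q ^+ B)).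
  rewrite hden geo -mulf_div divff // mul1r.
  by exists (k%:R / b%:R); apply: loc_div => //; rewrite pnatr_eq0 -lt0n.
have -> : q ^ A = y ^ a by rewrite DA mulrC -exprz_exp.
case: a {DA} => k; first by rewrite -exprnP.
rewrite NegzE -exprnN.
have y0 : y ^+ k.+1 != 0 by apply/expf_neq0/expf_neq0/q_neq0.
have -> : 1 - (y ^+ k.+1)^-1 = (- (y ^+ k.+1)^-1) * (1 - y ^+ k.+1).
  by rewrite mulrBr mulr1 mulNr opprK mulVf // addrC.
rewrite -mulrA; apply: regularM => //.
exists (- (1 ^+ k.+1)^-1); apply/locN/locV; last exact: locX.
by rewrite expr1n oner_eq0.
Qed.

End LocalPowers.

(** * Boundary terms modulo cyclotomic polynomials *)

(** Used with x = 1 - u, y = 1 / (1 - Q^j) and T the target summand, to isolate the Phi_n^3 carried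
    by (1 - u)^3. *)
Lemma cube_factor_out (R : comPzRingType) (P x y Pi c T : R) :
  P * (x * y * Pi) ^+ 3 * c - x ^+ 3 * T = x ^+ 3 * (P * (Pi * y) ^+ 3 * c - T).
Proof. by ring. Qed.

Section Congruences.

Variables (n d e : nat) (A : int) (z : algC).
Hypothesis hz : e.-primitive_root z.
Hypothesis en : (e %| n)%N.
Hypothesis d0 : (0 < d)%N.
Hypothesis hnd : coprime n d.
Hypothesis hA : (n %| A)%Z.

Let Q : ratfun := q ^+ d.
Let u : ratfun := q ^ A.
Let w : algC := z ^+ d.

Lemma Q_neq0 : Q != 0.
Proof. exact: expf_neq0 q_neq0. Qed.

Lemma one_subQ_neq0 k : 1 - Q ^+ k.+1 != 0.
Proof. by rewrite -exprM one_subq_neq0 // muln_gt0 d0. Qed.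

Lemma u_neq0 : u != 0.
Proof. exact: expfz_neq0 q_neq0. Qed.

Lemma w_prim : e.-primitive_root w.
Proof.
by rewrite prim_root_exp_coprime // coprime_sym (coprime_dvdl en).
Qed.

Lemma w_neq0 : w != 0.
Proof. exact: prim_root_neq0 w_prim. Qed.

Lemma dvd_eA (A' : int) : (n %| A')%Z -> (e %| A')%Z.
Proof. by apply: dvdz_trans; rewrite dvdzE. Qed.

Lemma dvdn_mul_d L : (e %| d * L)%N = (e %| L)%N.
Proof. by rewrite Gauss_dvdr // (coprime_dvdl en). Qed.

Lemma locQ : loc z Q w.
Proof. exact/locX/loc_q. Qed.

Lemma loc_qA (A' : int) : (n %| A')%Z -> loc z (q ^ A') 1.
Proof.
by move=> h; rewrite -(prim_expz hz (dvd_eA h)); apply: loc_qz hz _.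
Qed.

Lemma loc_sign k : loc z ((-1) ^+ k) ((-1) ^+ k).
Proof. exact/locX/locN/loc1. Qed.

Lemma loc_quot i : loc z (u / Q ^+ i) (1 / w ^+ i).
Proof.
apply: loc_div (loc_qA hA) (locX _ locQ).
by rewrite expf_neq0 // w_neq0.
Qed.

Lemma loc_unroll j : loc z (unroll Q u j) (unroll w 1 j).
Proof.
apply: locM (loc_sign _) _; apply: loc_div (locX _ (loc_qA hA)) (locX _ locQ).
by rewrite expf_neq0 // w_neq0.
Qed.

Lemma loc_unrollV j : loc z (unroll Q u j)^-1 (unroll w 1 j)^-1.
Proof.
apply: locV (loc_unroll j).
exact: (unroll_neq0 w_neq0 _ (oner_neq0 _)).
Qed.

Lemma regular_one_sub_ratio (A' : int) L : (0 < L)%N ->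
  ((e %| L)%N -> (e %| A')%Z) -> regular z ((1 - q ^ A') / (1 - Q ^+ L)).
Proof.
move=> L0 h; rewrite /Q -exprM; apply: (regular_ratio hz).
  by rewrite muln_gt0 d0.
by rewrite dvdn_mul_d.
Qed.

Lemma qz_divQ (A' : int) L : q ^ A' / Q ^+ L = q ^ (A' - (d * L)%:Z).
Proof. by rewrite (expfzDr _ _ q_neq0) -exprnN exprM. Qed.

Lemma qz_mulQ (A' : int) L : q ^ A' * Q ^+ L = q ^ (A' + (d * L)%:Z).
Proof. by rewrite (expfzDr _ _ q_neq0) -exprnP exprM. Qed.

Lemma dvd_eB (A' : int) L : (n %| A')%Z -> (e %| L)%N -> (e %| A' - (d * L)%:Z)%Z.
Proof.
by move=> h hL; apply: rpredB; rewrite ?dvdzE ?dvdn_mull //; apply: dvd_eA.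
Qed.

Lemma dvd_eD (A' : int) L : (n %| A')%Z -> (e %| L)%N -> (e %| A' + (d * L)%:Z)%Z.
Proof.
by move=> h hL; apply: rpredD; rewrite ?dvdzE ?dvdn_mull //; apply: dvd_eA.
Qed.

Lemma regular_factor (A' : int) L : (0 < L)%N -> (n %| A')%Z ->
  regular z (factor Q (q ^ A') L).
Proof.
move=> L0 h; rewrite /factor qz_divQ; apply: regular_one_sub_ratio => //.
exact: dvd_eB.
Qed.

Lemma regular_upfactor L : (0 < L)%N ->
  regular z ((1 - u * Q ^+ L) / (1 - Q ^+ L)).
Proof.
move=> L0; rewrite /u qz_mulQ; apply: regular_one_sub_ratio => //.
exact: dvd_eD.
Qed.

Lemma one_subw_neq0 L : ~~ (e %| L)%N -> 1 - w ^+ L != 0.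
Proof. by rewrite subr_eq0 eq_sym -(prim_order_dvd w_prim). Qed.

Lemma loc_one_subQ L : loc z (1 - Q ^+ L) (1 - w ^+ L).
Proof. by apply: locB (loc1 z) (locX _ locQ). Qed.

Lemma loc_factor (A' : int) L : ~~ (e %| L)%N -> (n %| A')%Z ->
  loc z (factor Q (q ^ A') L) (- (w ^+ L)^-1).
Proof.
move=> hL h; have w0 := expf_neq0 L w_neq0; have w1 := one_subw_neq0 hL.
have -> : - (w ^+ L)^-1 = (1 - 1 / w ^+ L) / (1 - w ^+ L).
  by field; rewrite w0 w1.
apply: loc_div w1 _ (loc_one_subQ L).
by apply: locB (loc1 z) _; apply: loc_div w0 (loc_qA h) (locX _ locQ).
Qed.

Lemma loc_upfactor L : ~~ (e %| L)%N ->
  loc z ((1 - u * Q ^+ L) / (1 - Q ^+ L)) 1.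
Proof.
move=> hL; have w1 := one_subw_neq0 hL.
rewrite -(divff w1); apply: loc_div w1 _ (loc_one_subQ L).
apply: locB (loc1 z) _; rewrite -(mul1r (w ^+ L)).
exact: locM (loc_qA hA) (locX _ locQ).
Qed.

Lemma vanishes_one_subu : vanishes e z 1 (1 - u).
Proof. exact: vanishes_one_subq hz _ (dvd_eA hA). Qed.

Lemma regular_ratio_u L : (0 < L)%N -> regular z ((1 - u) / (1 - Q ^+ L)).
Proof. by move=> L0; apply: regular_one_sub_ratio => // _; apply: dvd_eA. Qed.

Lemma vanishes_ratio_u L : ~~ (e %| L)%N -> vanishes e z 1 ((1 - u) / (1 - Q ^+ L)).
Proof.
move=> hL; apply: vanishesMr vanishes_one_subu _.
by exists (1 - w ^+ L)^-1; apply: locV (one_subw_neq0 hL) (loc_one_subQ L).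
Qed.

(** Shape shared by all terms to be estimated: [s] is a unit coefficient in the applications and [f]
    the remaining linear factor. One factor of the cube vanishes if e does not divide L; otherwise
    the cube is merely regular and [f] vanishes. *)
Lemma vanishes_cube L s f Pi c : (0 < L)%N ->
  regular z s -> regular z f -> regular z Pi -> regular z c ->
  ((e %| L)%N -> vanishes e z 1 f) ->
  vanishes e z 1 (s * f * ((1 - u) / (1 - Q ^+ L) * Pi) ^+ 3 * c).
Proof.
move=> L0 hs hf hPi hc h; apply: vanishesMr => //.
have [eL | eL] := boolP (e %| L)%N.
  apply: vanishesMr; first by apply: vanishesMl (h eL).
  by apply/regularX/regularM => //; apply: regular_ratio_u.
apply: vanishesMl; first exact: regularM.
rewrite exprS; apply: vanishesMr; last first.
  by apply/regularX/regularM => //; apply: regular_ratio_u.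
exact/vanishesMr/hPi/vanishes_ratio_u.
Qed.

(** Two factors 1 - u absorb the possible double pole of the summand; the third one vanishes. *)
Lemma vanishes_summand i :
  vanishes e z 1 ((1 - u) ^+ 3 * summand Q i.+1).
Proof.
rewrite cube_summand; apply: vanishesMr vanishes_one_subu _; apply: regularM.
  exact/regularX/regular_ratio_u.
exists ((-1) ^+ i.+1 * w ^+ 'C(i.+2, 2) * (1 + w ^+ i.+1)).
apply: locM; first by apply: locM (loc_sign _) (locX _ locQ).
by apply: locD (loc1 z) (locX _ locQ).
Qed.

Lemma loc_diag_coef i : loc z
  ((-1) ^+ i.+1 * (Q ^+ 'C(i.+2, 2) / (u / Q ^+ i.+1) ^+ i.+1))
  ((-1) ^+ i.+1 * (w ^+ 'C(i.+2, 2) / (1 / w ^+ i.+1) ^+ i.+1)).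
Proof.
apply: locM (loc_sign _) _; apply: loc_div (locX _ locQ) (locX _ (loc_quot _)).
by rewrite expf_neq0 // div1r invr_eq0 expf_neq0 // w_neq0.
Qed.

Lemma loc_diag_last i : loc z (1 - u / Q ^+ i.+1 / Q ^+ i.+1)
  (1 - 1 / w ^+ i.+1 / w ^+ i.+1).
Proof.
apply: locB (loc1 z) _; apply: loc_div (loc_quot _) (locX _ locQ).
by rewrite expf_neq0 // w_neq0.
Qed.

Lemma vanishes_diag i :
  vanishes e z 1 (diag_step Q (u / Q ^+ i.+1) i.+1 / unroll Q u i.+1).
Proof.
rewrite /diag_step (poch_ratio_down Q_neq0); apply: vanishes_cube => //.
- by eexists; apply: loc_diag_coef.
- by eexists; apply: loc_diag_last.
- by apply: regular_prod => l; apply: regular_factor.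
- by eexists; apply: loc_unrollV.
(* When e divides i + 1, both u and Q^(i+1) take the value 1, so the linear factor takes the value
   0. *)
move=> hi; apply: (loc0_vanishes hz); have := loc_diag_last i.
have -> : w ^+ i.+1 = 1 by apply/eqP; rewrite -(prim_order_dvd w_prim).
by rewrite !divr1 subrr.
Qed.

Lemma loc_summand j : ~~ (e %| j)%N -> loc z (summand Q j) (summand w j).
Proof.
move=> hj; apply: loc_div; first by apply/expf_neq0/one_subw_neq0.
  apply: locM; first by apply: locM (loc_sign _) (locX _ locQ).
  by apply: locD (loc1 z) (locX _ locQ).
exact/locX/loc_one_subQ.
Qed.

(** Makes u Q^n, the argument of the reversed factors in [poch_ratio_full], as good as u itself. *)
Lemma dvd_n_shift : (n %| A + (d * n)%:Z)%Z.
Proof. by apply: rpredD => //; rewrite dvdzE /= dvdn_mull. Qed.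

Lemma loc_cert_coef i k : loc z
  ((-1) ^+ k.+1 * Q ^+ 'C(k.+2, 2) / (u / Q ^+ i) ^+ k)
  ((-1) ^+ k.+1 * w ^+ 'C(k.+2, 2) / (1 / w ^+ i) ^+ k).
Proof.
apply: loc_div.
- by rewrite expf_neq0 // div1r invr_eq0 expf_neq0 // w_neq0.
- exact: locM (loc_sign _) (locX _ locQ).
- exact/locX/loc_quot.
Qed.

Lemma loc_cert_last i k : loc z ((u / Q ^+ i) ^+ 2 - (Q ^+ k)^-1)
  ((1 / w ^+ i) ^+ 2 - (w ^+ k)^-1).
Proof.
apply: locB; first exact/locX/loc_quot.
by apply: locV (locX _ locQ); rewrite expf_neq0 // w_neq0.
Qed.

Lemma vanishes_cert i k : n = (i.+1 + k).+1 ->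
  vanishes e z 1 (cert Q (u / Q ^+ i.+1) (i.+1 + k) / unroll Q u i.+1).
Proof.
move=> Dn; rewrite /cert (poch_ratio_full Q_neq0) -[_ * \prod_(_ < k) _]mulrA.
have -> : (i.+2 + k)%N = n by rewrite Dn.
apply: vanishes_cube => //.
- by eexists; apply: loc_cert_coef.
- by eexists; apply: loc_cert_last.
- apply: regularM; apply: regular_prod => l; rewrite ?/u ?qz_mulQ.
    exact: regular_factor.
  exact: regular_factor dvd_n_shift.
- by eexists; apply: loc_unrollV.
move=> hi; apply: (loc0_vanishes hz); have := loc_cert_last i.+1 (i.+1 + k).+1.
rewrite -Dn.
have -> : w ^+ i.+1 = 1 by apply/eqP; rewrite -(prim_order_dvd w_prim).
have -> : w ^+ n = 1 by apply/eqP; rewrite -(prim_order_dvd w_prim).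
by rewrite divr1 expr1n invr1 subrr.
Qed.

Lemma regular_prod_upfactor k : regular z
  (\prod_(l < k) ((1 - u * Q ^+ l.+1) / (1 - Q ^+ l.+1))).
Proof. by apply: regular_prod => l; apply: regular_upfactor. Qed.

Lemma loc_term_coef k : loc z ((-1) ^+ k * (Q ^+ 'C(k.+1, 2) / u ^+ k))
  ((-1) ^+ k * (w ^+ 'C(k.+1, 2) / 1 ^+ k)).
Proof.
apply: locM (loc_sign _) _; apply: loc_div (locX _ locQ) (locX _ (loc_qA hA)).
by rewrite expr1n oner_eq0.
Qed.

Lemma loc_term_last k : loc z (1 - u * Q ^+ k) (1 - 1 * w ^+ k).
Proof. by apply: locB (loc1 z) _; apply: locM (loc_qA hA) (locX _ locQ). Qed.

Lemma vanishes_term k : vanishes e z 1 (term Q u k.+1).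
Proof.
rewrite -[term _ _ _]mulr1 /term poch_ratio_up; apply: vanishes_cube => //.
- by eexists; apply: loc_term_coef.
- by eexists; apply: loc_term_last.
- exact: regular_prod_upfactor.
- by exists 1; apply: loc1.
move=> hk; apply: (loc0_vanishes hz); have := loc_term_last (2 * k.+1).
have -> : w ^+ (2 * k.+1) = 1.
  by apply/eqP; rewrite -(prim_order_dvd w_prim) dvdn_mull.
by rewrite mulr1 subrr.
Qed.

(** * The case e = n: congruences modulo Phi_n^4 *)

Hypothesis Den : e = n.

Lemma not_dvd l : (0 < l)%N -> (l < n)%N -> ~~ (e %| l)%N.
Proof. by move=> l0 ln; rewrite gtnNdvd // Den. Qed.

Lemma vanishes3_cube : vanishes e z 3 ((1 - u) ^+ 3).
Proof. exact: (vanishesX 3 vanishes_one_subu). Qed.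

Lemma congr_diag i : (i.+1 < n)%N ->
  vanishes e z 4 (diag_step Q (u / Q ^+ i.+1) i.+1 / unroll Q u i.+1
                  - (1 - u) ^+ 3 * summand Q i.+1).
Proof.
move=> lti; have hi := not_dvd (ltn0Sn i) lti; have w1 := one_subw_neq0 hi.
rewrite /diag_step (poch_ratio_down Q_neq0) cube_factor_out.
apply: (@vanishesM e z 3 1); first exact: vanishes3_cube.
apply: (loc0_vanishes hz).
(* The value 0 is expanded into a difference with the shape of the cofactor, so that it can be
   checked factor by factor. *)
rewrite -(subrr (summand w i.+1)) -{1}(diag_limit w_neq0 w1).
apply: locB (loc_summand hi); apply: locM (loc_unrollV _); apply: locM.
  exact: locM (loc_diag_coef i) (loc_diag_last i).
apply/locX/locM; last exact: locV w1 (loc_one_subQ _).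
apply: loc_prod => l; apply: loc_factor hA; apply: not_dvd => //.
by have := ltn_ord l; lia.
Qed.

Lemma congr_cert i k : n = (i.+1 + k).+1 ->
  vanishes e z 4 (cert Q (u / Q ^+ i.+1) (i.+1 + k) / unroll Q u i.+1
                  - (1 - u) ^+ 3 * summand Q i.+1).
Proof.
move=> Dn.
have hi : ~~ (e %| i.+1)%N by apply: not_dvd => //; rewrite Dn; lia.
have w1 := one_subw_neq0 hi.
rewrite /cert (poch_ratio_full Q_neq0) -[_ * \prod_(_ < k) _]mulrA cube_factor_out.
apply: (@vanishesM e z 3 1); first exact: vanishes3_cube.
apply: (loc0_vanishes hz); have Dne : e = (i.+1 + k).+1 by rewrite Den.
rewrite -(subrr (summand w i.+1)) -{1}(cert_limit w_neq0 w_prim Dne).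
apply: locB (loc_summand hi); apply: locM (loc_unrollV _); apply: locM.
  exact: locM (loc_cert_coef _ _) (loc_cert_last _ _).
apply/locX/locM; last exact: locV w1 (loc_one_subQ _).
apply: locM; apply: loc_prod => l.
  by apply: loc_factor hA; apply: not_dvd => //; rewrite Dn; have := ltn_ord l; lia.
have -> : (i.+2 + k)%N = n by rewrite Dn.
rewrite /u qz_mulQ; apply: loc_factor dvd_n_shift; apply: not_dvd => //.
by rewrite Dn; have := ltn_ord l; lia.
Qed.

Lemma congr_term k : (k.+1 < n)%N ->
  vanishes e z 4 (term Q u k.+1 - (1 - u) ^+ 3 * summand Q k.+1).
Proof.
move=> ltk; have hk := not_dvd (ltn0Sn k) ltk; have w1 := one_subw_neq0 hk.
rewrite -[term _ _ _]mulr1 /term poch_ratio_up cube_factor_out.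
apply: (@vanishesM e z 3 1); first exact: vanishes3_cube.
apply: (loc0_vanishes hz).
rewrite -(subrr (summand w k.+1)) -{1}(term_limit w1).
apply: locB (loc_summand hk); apply: locM (loc1 z); apply: locM.
  exact: locM (loc_term_coef _) (loc_term_last _).
apply/locX/locM; last exact: locV w1 (loc_one_subQ _).
apply: loc_prod => l; apply/loc_upfactor/not_dvd => //.
by have := ltn_ord l; lia.
Qed.

(** Termwise the sum is (1 - u)^3 times the sum of the [summand]s, whose value at [z] is 0 by
    [sum_summand]; this gives the fourth Phi_n. *)
Lemma congr_sum_term : vanishes e z 4 (\sum_(k < n.-1) term Q u k.+1).
Proof.
have -> : \sum_(k < n.-1) term Q u k.+1 =
    \sum_(k < n.-1) (term Q u k.+1 - (1 - u) ^+ 3 * summand Q k.+1)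
    + (1 - u) ^+ 3 * \sum_(k < n.-1) summand Q k.+1.
  by rewrite mulr_sumr -big_split; apply: eq_bigr => k _; rewrite /= subrK.
apply: vanishesD.
  apply: vanishes_sum => k; apply: congr_term.
  by have := ltn_ord k; lia.
apply: (@vanishesM e z 3 1); first exact: vanishes3_cube.
apply: (loc0_vanishes hz).
have two0 : 2%:R != 0 :> algC by rewrite pnatr_eq0.
rewrite -(sum_summand w_neq0 w_prim two0) Den; apply: loc_sum => k.
by apply/loc_summand/not_dvd => //; have := ltn_ord k; lia.
Qed.

End Congruences.

(** * The modulus *)

Lemma cyclotomicQ_root (e e' : nat) (z : algC) : (0 < e')%N ->
  e.-primitive_root z -> evalQ z (cyclotomicQ e') = 0 -> e = e'.
Proof.
move=> e'0 hz /eqP; have [z' hz'] := C_prim_root_exists e'0.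
rewrite /evalQ /cyclotomicQ -map_poly_comp.
rewrite (eq_map_poly (_ : (ratr \o intr) =1 (intr : int -> algC))); last first.
  by move=> x /=; rewrite ratr_int.
rewrite (Cintr_Cyclotomic hz') -/(root _ z) root_cyclotomic // => h.
apply/eqP; rewrite eqn_dvd (prim_order_dvd hz) (prim_expr_order h) eqxx.
by rewrite (prim_order_dvd h) (prim_expr_order hz) eqxx.
Qed.

Lemma cyclotomicQ_coprime2 (e e' : nat) : (0 < e)%N -> (0 < e')%N -> e != e' ->
  coprimep (cyclotomicQ e) (cyclotomicQ e').
Proof.
move=> e0 e'0 ne; have [z hz] := C_prim_root_exists e0.
apply: (cyclotomicQ_coprime hz); apply: contraNneq ne => h.
by apply/eqP; apply: cyclotomicQ_root h.
Qed.

(** Distinct cyclotomic polynomials are coprime, so the prime-power conditions combine. *)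
Lemma prod_cyclotomicQ_dvd (s : seq nat) (K : nat -> nat) (p : {poly rat}) :
  uniq s -> {in s, forall e, 0 < e}%N ->
  {in s, forall e, (cyclotomicQ e ^+ K e %| p)%R} ->
  (\prod_(e <- s) cyclotomicQ e ^+ K e %| p)%R.
Proof.
elim: s => [|e s IH] /=; first by rewrite big_nil dvd1p.
move=> /andP [es us] s0 hs; rewrite big_cons Gauss_dvdp.
  rewrite hs ?mem_head // IH // => e' he'; [apply: s0 | apply: hs].
    by rewrite inE he' orbT.
  by rewrite inE he' orbT.
rewrite big_seq; apply: (big_ind (coprimep _)).
- exact: coprimep1.
- by move=> x y hx hy; rewrite coprimepMr hx.
move=> e' he'; apply/coprimep_expl/coprimep_expr/cyclotomicQ_coprime2.
- by apply: s0; rewrite mem_head.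
- by apply: s0; rewrite inE he' orbT.
by apply: contraNneq es => ->.
Qed.

Lemma cyclotomicQ1 : cyclotomicQ 1 = 'X - 1.
Proof.
have := prod_Cyclotomic (ltn0Sn 0); rewrite big_seq1 => Phi1.
by rewrite /cyclotomicQ Phi1 rmorphB /= map_polyXn rmorph1.
Qed.

Lemma prod_cyclotomicQ n : (0 < n)%N ->
  \prod_(e <- divisors n) cyclotomicQ e = 'X^n - 1.
Proof.
move=> n0; rewrite -rmorph_prod prod_Cyclotomic //.
by rewrite rmorphB /= map_polyXn rmorph1.
Qed.

Lemma qint_poly_prod n : (0 < n)%N ->
  qint_poly n = \prod_(e <- rem 1%N (divisors n)) cyclotomicQ e.
Proof.
move=> n0; have X1 : 'X - 1 != 0 :> {poly rat} by rewrite -polyC1 polyXsubC_eq0.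
apply: (mulfI X1); rewrite -[LHS]subrX1 -prod_cyclotomicQ //.
have h1 : 1%N \in divisors n by rewrite -dvdn_divisors.
by rewrite (perm_big _ (perm_to_rem h1)) big_cons cyclotomicQ1.
Qed.

(* Exponent of [Phi_e] in the modulus [[n] Phi_n^3]. *)
Definition modulus_exp (n e : nat) : nat := if e == n then 4 else 1.

(** For n > 1 the divisor n survives the removal of 1, so [n] supplies one Phi_n in addition to the
    cube. *)
Lemma modulus_prod n : (1 < n)%N ->
  qint_poly n * cyclotomicQ n ^+ 3 =
    \prod_(e <- rem 1%N (divisors n)) cyclotomicQ e ^+ modulus_exp n e.
Proof.
move=> n1; rewrite qint_poly_prod 1?ltnW //.
have us : uniq (rem 1%N (divisors n)) by apply/rem_uniq/divisors_uniq.
have hn : n \in rem 1%N (divisors n).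
  rewrite mem_rem_uniq ?divisors_uniq // inE -dvdn_divisors 1?ltnW // dvdnn andbT.
  by rewrite neq_ltn n1 orbT.
rewrite (bigD1_seq n) //= [RHS](bigD1_seq n) //= /modulus_exp eqxx mulrAC.
by congr (_ * _); apply: eq_bigr => e /negbTE ->; rewrite expr1.
Qed.

Lemma modulus_neq0 n : (0 < n)%N -> qint_poly n * cyclotomicQ n ^+ 3 != 0.
Proof.
move=> n0; rewrite mulf_neq0 ?expf_neq0 //.
  rewrite -tofrac_eq0 qint_polyE /qint -exprnP; apply: mulf_neq0.
    exact: one_subq_neq0.
  by rewrite invr_eq0 -[q]expr1; apply: one_subq_neq0.
by have [z hz] := C_prim_root_exists n0; apply: cyclotomicQ_neq0.
Qed.

Lemma eqmod_of_vanishes n (x y : ratfun) : (1 < n)%N ->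
  (forall e z, (1 < e)%N -> (e %| n)%N -> e.-primitive_root z ->
     vanishes e z (modulus_exp n e) (x - y)) ->
  eqmod x y (qint_poly n * cyclotomicQ n ^+ 3).
Proof.
move=> n1 hv; have n0 := ltnW n1.
set P := _ * _.
have P0 : P != 0 := modulus_neq0 n0.
split=> //.
(* Regularity at a single primitive n-th root already presents the difference as a quotient of
   polynomials. *)
have [a [b [b0 hab]]] : exists a b : {poly rat}, b != 0 /\ x - y = tofrac a / tofrac b.
  have [z hz] := C_prim_root_exists n0.
  have [c [a [b [hb Dc _]]]] := vanishes_regular (hv n z n1 (dvdnn n) hz).
  by exists a, b; split=> //; have := tofrac_neq0 hb; rewrite tofrac_eq0.
pose g := gcdp a b.
have g0 : g != 0 by rewrite gcdp_eq0 negb_and b0 orbT.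
have Da : a = (a %/ g) * g by rewrite divpK // dvdp_gcdl.
have Db : b = (b %/ g) * g by rewrite divpK // dvdp_gcdr.
set a' := a %/ g in Da; set b' := b %/ g in Db.
have cop : coprimep a' b' by apply: coprimep_div_gcd; rewrite b0 orbT.
have b'0 : b' != 0 by apply: contraNneq b0 => h; rewrite Db h mul0r.
have Dxy : x - y = tofrac a' / tofrac b'.
  have hg : tofrac g != 0 by rewrite tofrac_eq0.
  by rewrite hab Da Db !tofracM -mulf_div divff // mulr1.
have : (P %| a')%R.
  rewrite /P modulus_prod //.
  have us : uniq (divisors n) := divisors_uniq n.
  apply: prod_cyclotomicQ_dvd => [|e|e]; first exact: rem_uniq.
    rewrite mem_rem_uniq // inE -dvdn_divisors // => /andP [_].
    exact: dvdn_gt0.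
  rewrite mem_rem_uniq // inE -dvdn_divisors // => /andP [e1 en].
  have e0 := dvdn_gt0 n0 en; have [z hz] := C_prim_root_exists e0.
  apply: (vanishes_dvdp hz b'0); rewrite -Dxy; apply: hv => //.
  by rewrite ltn_neqAle eq_sym e1.
(* As P divides the reduced numerator, the reduced denominator is coprime to P and to the quotient
   [c]. *)
case/dvdpP => c Dc; move: cop; rewrite Dc coprimepMl => /andP [cop copP].
exists c, b'; split=> //; last by rewrite coprimep_sym.
have hP : tofrac P != 0 by rewrite tofrac_eq0.
by rewrite Dxy Dc tofracM mulrAC mulfK.
Qed.

(** * The congruence *)

Section SumCongruence.

Variables (n d e : nat) (A : int) (z : algC).
Hypothesis hz : e.-primitive_root z.
Hypothesis en : (e %| n)%N.
Hypothesis d0 : (0 < d)%N.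
Hypothesis hnd : coprime n d.
Hypothesis hA : (n %| A)%Z.

Let Q : ratfun := q ^+ d.
Let u : ratfun := q ^ A.
Let K : nat := modulus_exp n e.

(** The prefactor is regular, so the initial value and the boundary terms may be compared
    separately. *)
Lemma vanishes_unrolled m (S s0 : ratfun) (E : nat -> ratfun) :
  S = unroll Q u m * (s0 + \sum_(i < m) E i) ->
  vanishes e z K (s0 - (1 - u)) ->
  (forall i, (i < m)%N -> vanishes e z K (E i - (1 - u) ^+ 3 * summand Q i.+1)) ->
  vanishes e z K
    (S - unroll Q u m * (1 - u + (1 - u) ^+ 3 * \sum_(i < m) summand Q i.+1)).
Proof.
move=> -> h0 hE; rewrite -mulrBr; apply: vanishesMl.
  by eexists; apply: (loc_unroll hz en hnd hA).
rewrite opprD addrACA; apply: vanishesD h0 _.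
rewrite mulr_sumr -sumrB; apply: vanishes_sum => i.
exact: hE.
Qed.

Lemma vanishes_diag_diff i : (i.+1 < n)%N ->
  vanishes e z K (diag_step Q (u / Q ^+ i.+1) i.+1 / unroll Q u i.+1
                  - (1 - u) ^+ 3 * summand Q i.+1).
Proof.
move=> lti; rewrite /K /modulus_exp; have [Den | _] := eqVneq e n.
  exact: (congr_diag hz en d0 hnd hA Den).
apply: vanishesB; first exact: (vanishes_diag hz en d0 hnd hA).
exact: (vanishes_summand hz en d0 hnd hA).
Qed.

Lemma vanishes_cert_diff i : (i.+1 < n)%N ->
  vanishes e z K (cert Q (u / Q ^+ i.+1) n.-1 / unroll Q u i.+1
                  - (1 - u) ^+ 3 * summand Q i.+1).
Proof.
move=> lti; have [k Dk] : exists k, n.-1 = (i.+1 + k)%N.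
  by exists (n.-1 - i.+1)%N; lia.
have Dn : n = (i.+1 + k).+1 by lia.
rewrite /K /modulus_exp Dk; have [Den | _] := eqVneq e n.
  exact: (congr_cert hz en d0 hnd hA Den).
(* For e < n the exponent is 1, and both sides vanish separately. *)
apply: vanishesB; first exact: (vanishes_cert hz en d0 hnd hA).
exact: (vanishes_summand hz en d0 hnd hA).
Qed.

Lemma vanishes_sum_term : vanishes e z K (\sum_(k < n.-1) term Q u k.+1).
Proof.
rewrite /K /modulus_exp; have [Den | _] := eqVneq e n.
  exact: (congr_sum_term hz en d0 hnd hA Den).
by apply: vanishes_sum => k; apply: (vanishes_term hz en d0 hnd hA).
Qed.

Lemma sum_term_congr m M : (m < n)%N -> M = m \/ M = (n - 1)%N ->
  vanishes e z K
    (\sum_(0 <= k < M.+1) term Q (u / Q ^+ m) k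
     - unroll Q u m * (1 - u + (1 - u) ^+ 3 * \sum_(i < m) summand Q i.+1)).
Proof.
have Q0 := Q_neq0 d; have Q1 := one_subQ_neq0 d0; have u0 := u_neq0 A.
move=> ltm [-> | ->].
  apply: vanishes_unrolled (sum_term_diag_unroll Q0 Q1 m u0) _ _.
    by rewrite subrr; apply: vanishes0.
  by move=> i ltim; apply: vanishes_diag_diff; apply: leq_ltn_trans ltm.
rewrite subn1; apply: vanishes_unrolled (sum_term_cert_unroll Q0 Q1 m n.-1 u0) _ _.
  rewrite big_mkord big_ord_recl.
  have -> : term Q u (ord0 : 'I_n.-1.+1) = 1 - u.
    by rewrite /term !poch0 !divr1 !expr1n !mul1r !mulr1.
  by rewrite addrAC subrr add0r; apply: vanishes_sum_term.
by move=> i ltim; apply: vanishes_cert_diff; apply: leq_ltn_trans ltm.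
Qed.

End SumCongruence.

(** * Translation into q-integers and conclusion *)

Lemma lhs_summandE (d : nat) (r : int) k :
  (-1) ^+ k * q ^ ((d * 'C(k.+1, 2))%:Z - k%:Z * r) * qint ((2 * d * k)%:Z + r)
    * (qpoch (q ^ r) (q ^+ d) k ^+ 3 / qpoch (q ^+ d) (q ^+ d) k ^+ 3)
  = (1 - q)^-1 * term (q ^+ d) (q ^ r) k.
Proof.
have -> : q ^ ((d * 'C(k.+1, 2))%:Z - k%:Z * r) =
    (q ^+ d) ^+ 'C(k.+1, 2) / (q ^ r) ^+ k.
  rewrite (expfzDr _ _ q_neq0) -exprnP exprM; congr (_ * _).
  by rewrite mulrC -invr_expz -exprz_exp -exprnP.
have -> : qint ((2 * d * k)%:Z + r) = (1 - q)^-1 * (1 - q ^ r * (q ^+ d) ^+ (2 * k)).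
  rewrite /qint (expfzDr _ _ q_neq0) -exprnP mulrC [q ^ r * _]mulrC -exprM.
  by rewrite mulnCA mulnA.
rewrite -expr_div_n /term /poch /qpoch.
by rewrite [_ * ((1 - q)^-1 * _)]mulrCA -!mulrA.
Qed.

(** The monomial of the right-hand side is the accumulated factor, because m^2 = 'C(m+1, 2) + 'C(m,
    2). *)
Lemma unroll_qE (d m : nat) (r : int) :
  (-1) ^+ m * q ^ ((d * 'C(m, 2))%:Z + m%:Z * r)
  = unroll (q ^+ d) (q ^ ((m * d)%:Z + r)) m.
Proof.
rewrite /unroll; congr (_ * _).
have h := expf_neq0 'C(m.+1, 2) (expf_neq0 d q_neq0).
apply: canRL (mulfK h) _.
rewrite -exprM !exprnP exprz_exp -(expfzDr _ _ q_neq0); congr (q ^ _).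
have hb := bin2_double m; rewrite bin_succ2 in hb *; nia.
Qed.

Lemma qint_summandE (d : nat) k :
  (-1) ^+ k.+1 * q ^+ (d * 'C(k.+2, 2)) * (1 + q ^+ (d * k.+1))
    / qint (k.+1 * d)%:Z ^+ 2
  = (1 - q) ^+ 2 * summand (q ^+ d) k.+1.
Proof.
rewrite /qint -exprnP [(k.+1 * d)%N]mulnC /summand -!exprM.
by rewrite expr_div_n invf_div mulrCA.
Qed.

Lemma rhs_regroup (F : fieldType) (c x y s : F) : y != 0 ->
  c * (x / y + (x / y) ^+ 3 * (y ^+ 2 * s)) = y^-1 * (c * (x + x ^+ 3 * s)).
Proof. by move=> y0; field. Qed.

Theorem theorem1p1 (n d : nat) (r : int) (m M : nat)
  (hn : (0 < n)%N) (hd : (0 < d)%N) (hnd : coprime n d)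
  (hrd : coprimez r d%:Z)
  (hmn : (m < n)%N) (hm : (m%:Z * d%:Z = - r %[mod n%:Z])%Z)
  (hM : M = m \/ M = (n - 1)%N) :
  eqmod
    (\sum_(0 <= k < M.+1)
       (-1) ^+ k * q ^ ((d * 'C(k.+1, 2))%:Z - k%:Z * r)
         * qint ((2 * d * k)%:Z + r)
         * (qpoch (q ^ r) (q ^+ d) k ^+ 3 / qpoch (q ^+ d) (q ^+ d) k ^+ 3))
    ((-1) ^+ m * q ^ ((d * 'C(m, 2))%:Z + m%:Z * r)
       * (qint ((m * d)%:Z + r)
          + qint ((m * d)%:Z + r) ^+ 3
            * \sum_(1 <= k < m.+1)
                (-1) ^+ k * q ^+ (d * 'C(k.+1, 2)) * (1 + q ^+ (d * k))
                  / qint (k * d)%:Z ^+ 2))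
    (qint_poly n * cyclotomicQ n ^+ 3).

Proof.
set lhs := (X in eqmod X _ _); set rhs := (X in eqmod _ X _).
pose A := (m * d)%:Z + r; pose Q := q ^+ d; pose u := q ^ A.
have q1 : 1 - q != 0 by rewrite -[q]expr1; apply: one_subq_neq0.
have Da : q ^ r = u / Q ^+ m by rewrite qz_divQ /A mulnC addrAC subrr add0r.
have Dlhs : lhs = (1 - q)^-1 * \sum_(0 <= k < M.+1) term Q (u / Q ^+ m) k.
  by rewrite /lhs mulr_sumr; apply: eq_bigr => k _; rewrite lhs_summandE Da.
have Drhs : rhs = (1 - q)^-1 *
    (unroll Q u m * (1 - u + (1 - u) ^+ 3 * \sum_(i < m) summand Q i.+1)).
  rewrite -(rhs_regroup _ _ _ q1) /rhs unroll_qE; congr (_ * (_ + _ * _)).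
  rewrite mulr_sumr big_add1 big_mkord; apply: eq_bigr => k _.
  exact: qint_summandE.
(* This is where the choice of m enters: u takes the value 1 at every n-th root of unity. *)
have hA : (n %| A)%Z.
  by rewrite /A PoszM -[r]opprK -eqz_mod_dvd; apply/eqP.
(* For n = 1 the modulus is a power of q - 1, where 1 / (1 - q) is not regular; but then m = M = 0
   and the two sides coincide. *)
have [n1 | n1] := leqP n 1.
  have Dn : n = 1%N by apply/eqP; rewrite eqn_leq n1.
  have Dm : m = 0%N by apply/eqP; rewrite -leqn0 -ltnS -Dn.
  have DM : M = m by case: hM => ->; rewrite ?Dm ?Dn.
  have Deq : lhs = rhs.
    rewrite Dlhs Drhs DM; congr (_ * _).
    rewrite (sum_term_diag_unroll (Q_neq0 d) (one_subQ_neq0 hd) m (u_neq0 A)).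
    by rewrite Dm !big_ord0 mulr0.
  split; first exact: modulus_neq0.
  by exists 0, 1; rewrite oner_eq0 coprimep1 coprime1p Deq subrr mul0r tofrac0 mul0r.
apply: eqmod_of_vanishes n1 _ => e z e1 en hz.
rewrite Dlhs Drhs -mulrBr; apply: vanishesMl.
  (* Since e > 1, the root [z] differs from 1 and 1 / (1 - q) is regular there. *)
  exists (1 - z)^-1; apply: locV; last by apply: locB (loc1 z) (loc_q z).
  rewrite subr_eq0 eq_sym -[z]expr1 -(prim_order_dvd hz).
  by rewrite gtnNdvd.
exact: (sum_term_congr hz en hd hnd hA hmn hM).
Qed.
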